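(* Let $G$ be a $(2n+1)$-dimensional real connected Lie group whose Lie algebra $\mathfrak{g}$ has a basis of left-invariant vector fields $\{x_0,x_1,\dots,x_{2n}\}$ with only non-zero commutators given by $[x_i,x_0]=\lambda_ix_0$ (equivalently $[x_0,x_i]=-\lambda_ix_0$), $i=1,\dots,2n$, where $\lambda_i\in\mathbb{R}$. Let the left-invariant almost contact structure $(\varphi,\xi,\eta)$ on $G$ be defined by $$\varphi x_i=x_{i+n},\quad \varphi x_{i+n}=-x_i\ (i=1,\dots,n),\quad \varphi x_0=0,\quad \xi=x_0,\quad \eta(x_0)=1,\quad \eta(x_j)=0\ (j=1,\dots,2n),$$ and let the left-invariant pseudo-Riemannian metric $g$ be defined by $$g(x_0,x_0)=g(x_i,x_i)=-g(x_{i+n},x_{i+n})=1\ (i=1,\dots,n),\qquad g(x_j,x_k)=0\ (j\neq k,\ j,k=0,1,\dots,2n).$$ Then the almost contact manifold with Norden metric $(G,\varphi,\xi,\eta,g)$ belongs to the class $\mathcal{F}_{11}$.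
   Context: An almost contact structure $(\varphi,\xi,\eta)$ on a $(2n+1)$-dimensional smooth manifold consists of an endomorphism $\varphi$ of the tangent bundle, a vector field $\xi$ and a 1-form $\eta$ with $\varphi^2=-\mathrm{Id}+\eta\otimes\xi$ and $\eta(\xi)=1$. A pseudo-Riemannian metric $g$ is a Norden metric ($B$-metric) if $g(\varphi x,\varphi y)=-g(x,y)+\eta(x)\eta(y)$ for all vector fields $x,y$; the manifold with $(\varphi,\xi,\eta,g)$ is then called an almost contact manifold with Norden metric. Let $\nabla$ be the Levi-Civita connection of $g$, put $F(x,y,z)=g((\nabla_x\varphi)y,z)$ and $\omega(x)=F(\xi,\xi,x)$. The manifold belongs to the class $\mathcal{F}_{11}$ if $F(x,y,z)=\eta(x)\{\eta(y)\omega(z)+\eta(z)\omega(y)\}$ for all vector fields $x,y,z$. *)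

(* Defs.v *)
From HB Require Import structures.
From mathcomp Require Import all_boot all_order all_algebra.
From mathcomp Require Import all_classical all_reals all_analysis.

Set Implicit Arguments.
Unset Strict Implicit.
Unset Printing Implicit Defensive.

Import Order.TTheory GRing.Theory Num.Theory.
Import numFieldNormedType.Exports.

Local Open Scope classical_set_scope.
Local Open Scope ring_scope.

(* C^k maps on a set U, meant for open U: f is C^(k+1) iff it is Frechet
   differentiable on U and each directional derivative x |-> 'd f x v is C^k.
   In finite dimension this is the usual notion. *)
Fixpoint Ck_on (R : realType) (V W : normedModType R) (k : nat)
    (U : set V) (f : V -> W) : Prop :=
  match k with
  | 0%N => forall x, U x -> {for x, continuous f}
  | k'.+1 => (forall x, U x -> differentiable f x) /\
             (forall v, Ck_on k' U (fun x => 'd f x v))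
  end.

Definition smooth_on (R : realType) (V W : normedModType R)
    (U : set V) (f : V -> W) : Prop := forall k, Ck_on k U f.

(* A homeomorphism between an open subset of M and an open subset of R^d;
   outside of these sets, chart_map and chart_inv carry no information. *)
Record chart (R : realType) (d : nat) (M : topologicalType) := Chart {
  chart_dom : set M;
  chart_map :> M -> 'rV[R]_d;
  chart_inv : 'rV[R]_d -> M;
  chart_dom_open : open chart_dom;
  chart_im_open : open (chart_map @` chart_dom);
  chart_mapK : forall p, chart_dom p -> chart_inv (chart_map p) = p;
  chart_map_continuous :
    forall p, chart_dom p -> {for p, continuous chart_map};
  chart_inv_continuous :
    forall u, (chart_map @` chart_dom) u -> {for u, continuous chart_inv}
}.

Definition chart_compatible (R : realType) (d : nat) (M : topologicalType)
    (c c' : chart R d M) : Prop :=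
  smooth_on (c @` (chart_dom c `&` chart_dom c')) (c' \o chart_inv c).

(* Smooth d-dimensional manifolds. The map chart_at chooses a chart around each
   point; it only serves to coordinatize the tangent spaces below. *)
HB.mixin Record isManifold (R : realType) (d : nat) M & Topological M := {
  atlas : set (chart R d M);
  chart_at : M -> chart R d M;
  chart_at_atlas : forall p, atlas (chart_at p);
  chart_at_dom : forall p, chart_dom (chart_at p) p;
  atlas_compatible :
    forall c c', atlas c -> atlas c' -> chart_compatible c c';
  manifold_hausdorff : hausdorff_space M;
  manifold_second_countable : @second_countable M
}.

#[short(type="manifoldType")]
HB.structure Definition Manifold (R : realType) (d : nat) :=
  { M of isManifold R d M & Topological M }.

Section Manifolds.
Context {R : realType} {d : nat}.

Definition smooth_fun (M : manifoldType R d) (f : M -> R) : Prop :=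
  forall c : chart R d M, atlas c ->
    smooth_on (c @` chart_dom c) (f \o chart_inv c).

Definition smooth_map (M N : manifoldType R d) (f : M -> N) : Prop :=
  continuous f /\
  forall (c : chart R d M) (c' : chart R d N), atlas c -> atlas c' ->
    smooth_on (c @` (chart_dom c `&` f @^-1` chart_dom c'))
              (c' \o f \o chart_inv c).

(* Smoothness of a map N * M -> Q, for the product manifold structure, whose
   charts are the products of charts of N and M. *)
Definition smooth_map2 (N M Q : manifoldType R d) (f : N -> M -> Q) : Prop :=
  continuous (fun pq : N * M => f pq.1 pq.2) /\
  forall (c1 : chart R d N) (c2 : chart R d M) (c3 : chart R d Q),
    atlas c1 -> atlas c2 -> atlas c3 ->
    smooth_on
      [set uv : 'rV[R]_d * 'rV[R]_d |
        [/\ (c1 @` chart_dom c1) uv.1, (c2 @` chart_dom c2) uv.2 &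
            chart_dom c3 (f (chart_inv c1 uv.1) (chart_inv c2 uv.2))]]
      (fun uv => c3 (f (chart_inv c1 uv.1) (chart_inv c2 uv.2))).

(* The tangent space of M at p is 'rV[R]_d: a tangent vector at p is given by
   its coordinates in the chart chart_at p. A vector field, not necessarily
   smooth, is thus a map M -> 'rV[R]_d. *)
Definition vfield (M : manifoldType R d) := M -> 'rV[R]_d.

Definition tangent_map (M N : manifoldType R d) (f : M -> N) (p : M)
    (v : 'rV[R]_d) : 'rV[R]_d :=
  'd (chart_at (f p) \o f \o chart_inv (chart_at p)) (chart_at p p) v.

Section VectorFields.
Context {M : manifoldType R d}.
Implicit Types (X Y Z : vfield M) (f : M -> R).

Definition deriv (X : vfield M) (f : M -> R) : M -> R := fun p =>
  'd (f \o chart_inv (chart_at p)) (chart_at p p) (X p).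

(* The coordinate expression, in the chart c, of X. *)
Definition in_chart (c : chart R d M) (X : vfield M) (u : 'rV[R]_d)
    : 'rV[R]_d :=
  let p := chart_inv c u in
  'd (c \o chart_inv (chart_at p)) (chart_at p p) (X p).

Definition smooth_vfield (X : vfield M) : Prop :=
  forall c : chart R d M, atlas c -> smooth_on (c @` chart_dom c) (in_chart c X).

(* In local coordinates, [X, Y]^i = X^j d_j Y^i - Y^j d_j X^i. *)
Definition bracket (X Y : vfield M) : vfield M := fun p =>
  let c := chart_at p in
  'd (in_chart c Y) (c p) (X p) - 'd (in_chart c X) (c p) (Y p).

Definition vscale (f : M -> R) (X : vfield M) : vfield M :=
  fun p => f p *: X p.

Definition vadd (X Y : vfield M) : vfield M := fun p => X p + Y p.

Definition pseudo_riemannian (g : M -> {biscalar 'rV[R]_d}) : Prop :=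
  [/\ forall p u v, g p u v = g p v u,
      forall p u, (forall v, g p u v = 0) -> u = 0 &
      forall X Y, smooth_vfield X -> smooth_vfield Y ->
        smooth_fun (fun p => g p (X p) (Y p))].

(* Connections are operators on smooth vector fields; their values on
   non-smooth ones are irrelevant. *)
Definition affine_connection (nabla : vfield M -> vfield M -> vfield M)
    : Prop :=
  (forall X Y, smooth_vfield X -> smooth_vfield Y ->
     smooth_vfield (nabla X Y)) /\
  [/\ forall X X' Y, smooth_vfield X -> smooth_vfield X' -> smooth_vfield Y ->
        nabla (vadd X X') Y = vadd (nabla X Y) (nabla X' Y),
      forall f X Y, smooth_fun f -> smooth_vfield X -> smooth_vfield Y ->
        nabla (vscale f X) Y = vscale f (nabla X Y),
      forall X Y Y', smooth_vfield X -> smooth_vfield Y -> smooth_vfield Y' ->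
        nabla X (vadd Y Y') = vadd (nabla X Y) (nabla X Y') &
      forall f X Y, smooth_fun f -> smooth_vfield X -> smooth_vfield Y ->
        nabla X (vscale f Y) =
          vadd (vscale (deriv X f) Y) (vscale f (nabla X Y))].

Definition levi_civita (g : M -> {biscalar 'rV[R]_d})
    (nabla : vfield M -> vfield M -> vfield M) : Prop :=
  [/\ affine_connection nabla,
      forall X Y, smooth_vfield X -> smooth_vfield Y ->
        forall p, nabla X Y p - nabla Y X p = bracket X Y p &
      forall X Y Z, smooth_vfield X -> smooth_vfield Y -> smooth_vfield Z ->
        forall p, deriv X (fun q => g q (Y q) (Z q)) p =
                  g p (nabla X Y p) (Z p) + g p (Y p) (nabla X Z p)].

Definition almost_contact (phi : M -> {linear 'rV[R]_d -> 'rV[R]_d})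
    (xi : vfield M) (eta : M -> {scalar 'rV[R]_d}) : Prop :=
  [/\ forall X, smooth_vfield X -> smooth_vfield (fun p => phi p (X p)),
      smooth_vfield xi,
      forall X, smooth_vfield X -> smooth_fun (fun p => eta p (X p)),
      forall p v, phi p (phi p v) = - v + eta p v *: xi p &
      forall p, eta p (xi p) = 1].

Definition almost_contact_norden (phi : M -> {linear 'rV[R]_d -> 'rV[R]_d})
    (xi : vfield M) (eta : M -> {scalar 'rV[R]_d})
    (g : M -> {biscalar 'rV[R]_d}) : Prop :=
  [/\ almost_contact phi xi eta, pseudo_riemannian g &
      forall p u v, g p (phi p u) (phi p v) = - g p u v + eta p u * eta p v].

Definition nabla_phi (nabla : vfield M -> vfield M -> vfield M)
    (phi : M -> {linear 'rV[R]_d -> 'rV[R]_d}) (X Y : vfield M) : vfield M :=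
  fun p => nabla X (fun q => phi q (Y q)) p - phi p (nabla X Y p).

Definition F_tensor (nabla : vfield M -> vfield M -> vfield M)
    (phi : M -> {linear 'rV[R]_d -> 'rV[R]_d}) (g : M -> {biscalar 'rV[R]_d})
    (X Y Z : vfield M) : M -> R :=
  fun p => g p (nabla_phi nabla phi X Y p) (Z p).

Definition class_F11 (phi : M -> {linear 'rV[R]_d -> 'rV[R]_d})
    (xi : vfield M) (eta : M -> {scalar 'rV[R]_d})
    (g : M -> {biscalar 'rV[R]_d})
    (nabla : vfield M -> vfield M -> vfield M) : Prop :=
  let F := F_tensor nabla phi g in
  let omega := F xi xi in
  forall X Y Z, smooth_vfield X -> smooth_vfield Y -> smooth_vfield Z ->
  forall p, F X Y Z p =
    eta p (X p) * (eta p (Y p) * omega Z p + eta p (Z p) * omega Y p).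

End VectorFields.
End Manifolds.

HB.mixin Record isLieGroup (R : realType) (d : nat) G
    & Manifold R d G & Group G := {
  lie_mul_smooth : smooth_map2 (fun a b : G => (a * b)%g);
  lie_inv_smooth : smooth_map (fun a : G => (a^-1)%g)
}.

#[short(type="lieGroupType")]
HB.structure Definition LieGroup (R : realType) (d : nat) :=
  { G of isLieGroup R d G & Manifold R d G & Group G }.

Section LieGroups.
Context {R : realType} {d : nat} {G : lieGroupType R d}.

Definition left_invariant (X : vfield G) : Prop :=
  forall a p : G, tangent_map (fun q : G => (a * q)%g) p (X p) = X (a * p)%g.

(* x is a basis of the Lie algebra of G, that is, of the real vector space of
   smooth left-invariant vector fields. *)
Definition lie_algebra_basis (k : nat) (x : 'I_k -> vfield G) : Prop :=
  (forall i, smooth_vfield (x i) /\ left_invariant (x i)) /\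
  (forall X : vfield G, smooth_vfield X -> left_invariant X ->
     exists! a : 'rV[R]_k, forall p, X p = \sum_(i < k) a 0 i *: x i p).

End LieGroups.

(* Main.v *)
Require Import Defs.
From HB Require Import structures.
From mathcomp Require Import all_boot all_order all_algebra.
From mathcomp Require Import all_classical all_reals all_analysis.
From mathcomp Require Import ring lra zify.

Import Order.TTheory GRing.Theory Num.Theory.
Import numFieldNormedType.Exports.

Local Open Scope classical_set_scope.
Local Open Scope ring_scope.

(** The vector fields x_i are smooth and g-orthogonal with squares 1 or -1, so
   they form a basis of every tangent space. Everything is tensorial, hence
   can be checked on this frame, where all structure functions are constant.

   Passing from the frame to arbitrary smooth fields needs the frame to
   generate the smooth fields over the ring of smooth functions
   ([frame_ind]). In a chart, the coefficients of a field are its components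
   times the inverse of the matrix of components of the frame, and C^k
   functions are stable under sums, products and inverses, hence under the
   entries of an inverse matrix ([Ck_on_invmx], [smooth_frame_coef]). That this
   matrix is invertible in every chart, and not only in the chosen chart at
   each point, comes from the invertibility of the differentials of the
   changes of charts ([transition_diff_inj]). It follows that phi, eta and g
   are smooth; the algebraic identities are checked on the frame. The Norden
   identity is deduced from phi^2 = - id + eta (x) xi and the fact that phi is
   g-self-adjoint.

   For the class F_11, the inner products of the x_i being constant, Koszul's
   formula reduces to its bracket terms ([koszul_constant]) and gives, with d
   the Kronecker symbol ([nabla_frame]),

     g(nabla_{x_i} x_j, x_k) = d_i0 (lambda_k d_j0 - lambda_j d_k0).

   Since phi x_j = s_j x_j' with j' <> 0 unless s_j = 0, and phi is
   self-adjoint, F(x_i, x_j, x_k) = g(nabla_{x_i} phi x_j, x_k)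
   - g(nabla_{x_i} x_j, phi x_k) equals
   d_i0 (- s_j lambda_j' d_k0 - s_k lambda_k' d_j0). Taking i = j = 0 yields
   omega(x_k) = - s_k lambda_k', and substituting it back is the defining
   identity of F_11. *)

(** * C^k functions on open sets of normed modules *)

(** The differential at x depends only on the germ at x: this is what lets the
   derivatives below be computed on an open set only. *)
Lemma near_eq_is_diff {R : realType} {V W : normedModType R} {f g : V -> W}
    {x : V} :
  {near x, f =1 g} -> differentiable f x -> is_diff x g ('d f x).
Proof.
move=> fg df.
have e : g \o shift x = cst (g x) + 'd f x +o_ 0 id.
  apply/eqaddoP => _/posnumP[e].
  have /eqaddoP/(_ e%:num (gt0 e)) := diff_locally df.
  have fg0 : \forall h \near 0, f (h + x) = g (h + x).
    have : \forall y \near x, f y = g y by [].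
    by rewrite (near_shift 0 x) /= subr0.
  apply: filterS2 fg0 => h; rewrite !fctE /= => fgh.
  by rewrite fgh -(nbhs_singleton fg).
have dc := diff_continuous df.
have dE := diff_unique dc e.
by apply: DiffDef => //; apply/diff_locallyP; rewrite dE.
Qed.

Lemma open_near_eq {T T' : topologicalType} {U : set T} {f g : T -> T'} {x : T} :
  open U -> (forall y, U y -> f y = g y) -> U x -> {near x, f =1 g}.
Proof.
by move=> oU fg Ux; apply: filterS (open_nbhs_nbhs (conj oU Ux)) => y /fg.
Qed.

Lemma Ck_on_ext {R : realType} {V W : normedModType R} {k} {U : set V}
    {f g : V -> W} :
  open U -> (forall x, U x -> f x = g x) -> Ck_on k U f -> Ck_on k U g.
Proof.
move=> oU; elim: k f g => [|k IH] f g fg /=.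
  move=> cf x Ux.
  suff: g @ x --> f x by rewrite (fg x Ux).
  apply: cvg_trans (cf x Ux).
  by apply: near_eq_cvg; exact: open_near_eq oU fg Ux.
move=> [df dfk].
have dg x Ux : is_diff x g ('d f x) :=
  near_eq_is_diff (open_near_eq oU fg Ux) (df x Ux).
split=> [x Ux|v]; first by have := dg x Ux => ?; exact: ex_diff.
apply: IH (dfk v) => x Ux.
by have := dg x Ux => ?; rewrite (diff_val (df := 'd f x)).
Qed.

Lemma Ck_onS {R : realType} {V W : normedModType R} {k} {U : set V}
    {f : V -> W} : Ck_on k.+1 U f -> Ck_on k U f.
Proof.
elim: k f => [|k IH] f [df dfk] /=.
  by move=> x Ux; exact/differentiable_continuous/df.
by split=> // v; exact: IH (dfk v).
Qed.

Lemma Ck_on_cst {R : realType} {V W : normedModType R} k (U : set V) (a : W) :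
  Ck_on k U (cst a).
Proof.
elim: k a => [|k IH] a /=; first by move=> x _; exact: cst_continuous.
split=> [x _|v]; first exact: differentiable_cst.
rewrite [X in Ck_on k U X](_ : _ = cst 0); first exact: IH.
by apply/funext => x; rewrite diff_cst.
Qed.

Lemma Ck_onD {R : realType} {V W : normedModType R} {k} {U : set V}
    {f g : V -> W} :
  open U -> Ck_on k U f -> Ck_on k U g -> Ck_on k U (fun x => f x + g x).
Proof.
move=> oU; elim: k f g => [|k IH] f g /=.
  by move=> cf cg x Ux; apply: continuousD; [exact: cf|exact: cg].
move=> [df dfk] [dg dgk]; split=> [x Ux|v].
  by apply: differentiableD; [exact: df|exact: dg].
apply: Ck_on_ext oU _ (IH _ _ (dfk v) (dgk v)) => x Ux.
by rewrite (diffD (df x Ux) (dg x Ux)).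
Qed.

Lemma Ck_on_lin {R : realType} {V W W' : normedModType R} {k} {U : set V}
    (L : {linear W -> W'}) {f : V -> W} :
  continuous L -> open U -> Ck_on k U f -> Ck_on k U (L \o f).
Proof.
move=> cL oU; elim: k f => [|k IH] f /=.
  by move=> cf x Ux; apply: continuous_comp; [exact: cf|exact: cL].
move=> [df dfk]; split=> [x Ux|v].
  apply: differentiable_comp; first exact: df.
  exact: linear_differentiable.
apply: Ck_on_ext oU _ (IH _ (dfk v)) => x Ux.
have dL : differentiable L (f x) by exact: linear_differentiable.
by rewrite (diff_comp (df x Ux) dL) /= diff_lin.
Qed.

(** Scaling is given a bilinear structure so that the product rule for h *: f
   is an instance of the differential of a continuous bilinear map. *)
Lemma scale_is_bilinear {R : realType} {W : normedModType R} :
  bilinear_for (GRing.Scale.Law.clone _ _ *:%R _)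
    (GRing.Scale.Law.clone _ _ *:%R _) (@GRing.scale R W : R^o -> W -> W).
Proof.
split=> [u'|u] a x y /=; first by rewrite scalerDl scalerA.
by rewrite scalerDr !scalerA mulrC.
Qed.

HB.instance Definition _ (R : realType) (W : normedModType R) :=
  bilinear_isBilinear.Build R R^o W W _ _ (@GRing.scale R W : R^o -> W -> W)
    scale_is_bilinear.

Lemma is_diff_scale {R : realType} {V W : normedModType R}
    (h : V -> R) (f : V -> W) x :
  differentiable h x -> differentiable f x ->
  is_diff x (fun y => h y *: f y) (fun v => 'd h x v *: f x + h x *: 'd f x v).
Proof.
move=> dh df.
have sc : continuous (fun z : R^o * W => z.1 *: z.2) by exact: scale_continuous.
have dp := differentiable_pair dh df.
have db := @differentiable_bilin _ _ _ _ (@GRing.scale R W : R^o -> W -> W)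
  (h x, f x) sc.
apply: DiffDef; first exact: (differentiable_comp dp db).
rewrite [LHS](diff_comp dp db) diff_bilin // diff_pair //.
by apply/funext => v /=; rewrite addrC.
Qed.

(** By the product rule the derivative of h *: f is a sum of two such products,
   of C^k factors if h and f are C^(k+1), so that induction on k applies. *)
Lemma Ck_on_scale {R : realType} {V W : normedModType R} {k} {U : set V}
    {h : V -> R} {f : V -> W} :
  open U -> Ck_on k U h -> Ck_on k U f -> Ck_on k U (fun x => h x *: f x).
Proof.
move=> oU; elim: k h f => [|k IH] h f /=.
  by move=> ch cf x Ux; apply: continuousZ; [exact: ch|exact: cf].
move=> Ch Cf; have [[dh dhk] [df dfk]] := (Ch, Cf).
have ds x Ux := is_diff_scale h f x (dh x Ux) (df x Ux).
split=> [x Ux|v]; first by have := ds x Ux => ?; exact: ex_diff.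
have Ch' := Ck_onS Ch; have Cf' := Ck_onS Cf.
apply: Ck_on_ext oU _ (Ck_onD oU (IH _ _ (dhk v) Cf') (IH _ _ Ch' (dfk v))).
by move=> x Ux; have := ds x Ux => ?; rewrite diff_val.
Qed.

Lemma Ck_onM {R : realType} {V : normedModType R} {k} {U : set V}
    {f g : V -> R} :
  open U -> Ck_on k U f -> Ck_on k U g -> Ck_on k U (fun x => f x * g x).
Proof. exact: (@Ck_on_scale _ _ R^o). Qed.

(** The derivative - f^-2 *: 'd f of the inverse involves f^-1 itself, which is
   C^k by induction, and the C^k function 'd f. *)
Lemma Ck_onV {R : realType} {V : normedModType R} {k} {U : set V}
    {f : V -> R} :
  open U -> (forall x, U x -> f x != 0) -> Ck_on k U f ->
  Ck_on k U (fun x => (f x)^-1).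
Proof.
move=> oU f0; elim: k => [|k IH] /=.
  by move=> cf x Ux; apply: continuousV; [exact: f0|exact: cf].
move=> Cf; have [df dfk] := Cf.
split=> [x Ux|v]; first by apply: differentiableV; [exact: df|exact: f0].
have CV := IH (Ck_onS Cf).
have := Ck_onM oU (Ck_onM oU (Ck_on_cst k U (-1 : R)) (Ck_onM oU CV CV)) (dfk v).
apply: Ck_on_ext oU _ => x Ux.
by rewrite (diffV (df x Ux) (f0 x Ux)) /= mulN1r -invfM -expr2 -exprVn.
Qed.

Lemma Ck_on_coord {R : realType} {V : normedModType R} {k} {U : set V} {m n}
    {f : V -> 'M[R]_(m, n)} i j :
  open U -> Ck_on k U f -> Ck_on k U (fun x => f x i j).
Proof.
pose L (A : 'M[R]_(m, n)) : R^o := A i j.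
have L_lin : linear L by move=> a A B; rewrite /L !mxE.
pose LL : {linear _ -> _} := HB.pack L (GRing.isLinear.Build _ _ _ _ _ L_lin).
exact: (@Ck_on_lin _ _ _ _ k U LL f (@coord_continuous _ m n i j)).
Qed.

(** The chain rule applied to g \o f, which is locally the identity, makes
   'd g (f x) a left inverse of 'd f x. *)
Lemma near_left_inverse_diff_inj {R : realType} {V W : normedModType R}
    {f : V -> W} {g : W -> V} {x : V} :
  differentiable f x -> differentiable g (f x) -> {near x, g \o f =1 id} ->
  forall v, 'd f x v = 0 -> v = 0.
Proof.
move=> df dg gf v dfv0.
have dcomp := @diff_val _ _ _ _ _ _ _
  (near_eq_is_diff gf (differentiable_comp df dg)).
have did := @diff_val _ _ _ _ _ _ _ (@is_diff_id R V x).
have := congr1 (@^~ v) (etrans (esym did) (etrans dcomp (diff_comp df dg))).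
by rewrite /= dfv0 linear0.
Qed.

Lemma Ck_on_sum {R : realType} {V W : normedModType R} {k} {U : set V} {I}
    (r : seq I) (F : I -> V -> W) :
  open U -> (forall i, Ck_on k U (F i)) ->
  Ck_on k U (fun x => \sum_(i <- r) F i x).
Proof.
move=> oU CF; elim: r => [|i r IH].
  by apply: Ck_on_ext oU _ (Ck_on_cst k U (0 : W)) => x _; rewrite big_nil.
by apply: Ck_on_ext oU _ (Ck_onD oU (CF i) IH) => x _; rewrite big_cons.
Qed.

Lemma Ck_on_prod {R : realType} {V : normedModType R} {k} {U : set V} {I}
    (r : seq I) (F : I -> V -> R) :
  open U -> (forall i, Ck_on k U (F i)) ->
  Ck_on k U (fun x => \prod_(i <- r) F i x).
Proof.
move=> oU CF; elim: r => [|i r IH].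
  by apply: Ck_on_ext oU _ (Ck_on_cst k U (1 : R)) => x _; rewrite big_nil.
by apply: Ck_on_ext oU _ (Ck_onM oU (CF i) IH) => x _; rewrite big_cons.
Qed.

Lemma Ck_on_det {R : realType} {V : normedModType R} {k} {U : set V} {n}
    {A : V -> 'M[R]_n} :
  open U -> (forall i j, Ck_on k U (fun x => A x i j)) ->
  Ck_on k U (fun x => \det (A x)).
Proof.
move=> oU CA; apply: Ck_on_sum => // s.
apply: Ck_onM => //; first exact: Ck_on_cst.
exact: Ck_on_prod.
Qed.

(** By Cramer's rule the entries of the inverse are the cofactors, polynomial in
   the entries, divided by the nonvanishing determinant. *)
Lemma Ck_on_invmx {R : realType} {V : normedModType R} {k} {U : set V} {n}
    {A : V -> 'M[R]_n} :
  open U -> (forall x, U x -> A x \in unitmx) ->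
  (forall i j, Ck_on k U (fun x => A x i j)) ->
  forall i j, Ck_on k U (fun x => invmx (A x) i j).
Proof.
move=> oU uA CA i j.
have Cdet : Ck_on k U (fun x => (\det (A x))^-1).
  by apply: Ck_onV oU _ (Ck_on_det oU CA) => x /uA; rewrite unitmxE unitfE.
have Ccof : Ck_on k U (fun x => cofactor (A x) j i).
  apply: Ck_onM => //; first exact: Ck_on_cst.
  apply: Ck_on_det => // i' j'.
  by apply: Ck_on_ext oU _ (CA (lift j i') (lift i j')) => x _; rewrite !mxE.
apply: Ck_on_ext oU _ (Ck_onM oU Cdet Ccof) => x Ux.
by rewrite /invmx uA // !mxE.
Qed.

(** * Changes of charts and smooth frames *)

Section Frames.
Context {R : realType} {d : nat} {M : manifoldType R d}.
Implicit Types (X Y Z : vfield M) (f : M -> R) (c : chart R d M).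

Lemma chart_open c : open (c @` chart_dom c).
Proof. exact: chart_im_open. Qed.

Lemma chart_overlap_open c c' : open (c @` (chart_dom c `&` chart_dom c')).
Proof.
rewrite openE => _ [p [cp c'p] <-].
have im_cp : (c @` chart_dom c) (c p) by exists p.
have near_im := open_nbhs_nbhs (conj (chart_open c) im_cp).
have near_c' : \forall u \near c p, chart_dom c' (chart_inv c u).
  apply: (chart_inv_continuous im_cp); rewrite chart_mapK //.
  exact: open_nbhs_nbhs (conj (chart_dom_open c') c'p).
apply: filterS2 near_im near_c' => _ [q cq <-]; rewrite chart_mapK // => c'q.
by exists q.
Qed.

Lemma transition_differentiable {c c'} {p : M} :
  atlas c -> atlas c' -> chart_dom c p -> chart_dom c' p ->
  differentiable (c' \o chart_inv c) (c p).
Proof.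
move=> ac ac' cp c'p.
have [+ _] := atlas_compatible c c' ac ac' 1.
by apply; exists p.
Qed.

Lemma transition_diff_inj {c c'} {p : M} :
  atlas c -> atlas c' -> chart_dom c p -> chart_dom c' p ->
  forall v, 'd (c' \o chart_inv c) (c p) v = 0 -> v = 0.
Proof.
move=> ac ac' cp c'p v Tv0.
have dT := transition_differentiable ac ac' cp c'p.
have e : (c' \o chart_inv c) (c p) = c' p by rewrite /= chart_mapK.
have dT' : differentiable (c \o chart_inv c') ((c' \o chart_inv c) (c p)).
  by rewrite e; exact: transition_differentiable.
have id_near : {near c p, (c \o chart_inv c') \o (c' \o chart_inv c) =1 id}.
  apply: (open_near_eq (chart_overlap_open c c')) => [_ [q [cq c'q] <-]|].
    by rewrite /= (chart_mapK cq) chart_mapK.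
  by exists p.
exact: near_left_inverse_diff_inj dT dT' id_near v Tv0.
Qed.

Lemma in_chart_vadd c X Y u :
  in_chart c (vadd X Y) u = in_chart c X u + in_chart c Y u.
Proof. exact: linearD. Qed.

Lemma in_chart_vscale c f X u :
  in_chart c (vscale f X) u = f (chart_inv c u) *: in_chart c X u.
Proof. exact: linearZ. Qed.

Lemma smooth_vadd X Y :
  smooth_vfield X -> smooth_vfield Y -> smooth_vfield (vadd X Y).
Proof.
move=> sX sY c ac k; have oU := chart_open c.
apply: Ck_on_ext oU _ (Ck_onD oU (sX c ac k) (sY c ac k)) => u _.
by rewrite in_chart_vadd.
Qed.

Lemma smooth_vscale f X :
  smooth_fun f -> smooth_vfield X -> smooth_vfield (vscale f X).
Proof.
move=> sf sX c ac k; have oU := chart_open c.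
apply: Ck_on_ext oU _ (Ck_on_scale oU (sf c ac k) (sX c ac k)) => u _.
by rewrite in_chart_vscale.
Qed.

Lemma smooth_fun_cst (a : R) : smooth_fun (fun _ : M => a).
Proof. by move=> c _ k; exact: Ck_on_cst. Qed.

Lemma smooth_funD f f' :
  smooth_fun f -> smooth_fun f' -> smooth_fun (fun p => f p + f' p).
Proof.
by move=> sf sf' c ac k; exact: (Ck_onD (chart_open c) (sf c ac k) (sf' c ac k)).
Qed.

Lemma smooth_funM f f' :
  smooth_fun f -> smooth_fun f' -> smooth_fun (fun p => f p * f' p).
Proof.
by move=> sf sf' c ac k; exact: (Ck_onM (chart_open c) (sf c ac k) (sf' c ac k)).
Qed.

Definition frame_mx (x : 'I_d -> vfield M) (p : M) : 'M[R]_d :=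
  \matrix_i x i p.

Definition smooth_frame (x : 'I_d -> vfield M) : Prop :=
  (forall i, smooth_vfield (x i)) /\ forall p, frame_mx x p \in unitmx.

Definition frame_coef (x : 'I_d -> vfield M) X (p : M) : 'rV[R]_d :=
  X p *m invmx (frame_mx x p).

Section Frame.
Context {x : 'I_d -> vfield M} (x_frame : smooth_frame x).

Lemma frame_mxE p (a : 'rV_d) : a *m frame_mx x p = \sum_i a 0 i *: x i p.
Proof. by rewrite mulmx_sum_row; apply: eq_bigr => i _; rewrite rowK. Qed.

Lemma frame_coefE X p : X p = \sum_i frame_coef x X p 0 i *: x i p.
Proof. by rewrite -frame_mxE mulmxKV // x_frame.2. Qed.

(** In the chart c, the coefficients are the product of the smooth components of X
   by the inverse of the matrix of the components of the frame. *)
Lemma smooth_frame_coef X i :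
  smooth_vfield X -> smooth_fun (fun p => frame_coef x X p 0 i).
Proof.
move=> sX c ac k; have oU := chart_open c.
pose B u : 'M[R]_d := \matrix_j in_chart c (x j) u.
(* in_chart c applies to each vector the differential T of the change from
   chart_at p to c, so a linear combination of the rows of B is the image under
   T of the same combination of the frame; T being injective, B is invertible. *)
have BE u a : a *m B u =
    'd (c \o chart_inv (chart_at (chart_inv c u)))
      (chart_at (chart_inv c u) (chart_inv c u))
      (a *m frame_mx x (chart_inv c u)).
  rewrite frame_mxE linear_sum mulmx_sum_row; apply: eq_bigr => j _.
  by rewrite rowK linearZ.
have uB u : (c @` chart_dom c) u -> B u \in unitmx.
  case=> p cp <-; rewrite -row_free_unit; apply: inj_row_free => v.
  rewrite BE chart_mapK // => /(transition_diff_inj (chart_at_atlas p) ac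
    (chart_at_dom p) cp) /(congr1 (mulmx^~ (invmx (frame_mx x p)))).
  by rewrite mul0mx mulmxK // x_frame.2.
have CB j l : Ck_on k (c @` chart_dom c) (fun u => B u j l).
  apply: Ck_on_ext oU _ (Ck_on_coord 0 l oU (x_frame.1 j c ac k)) => u _.
  by rewrite mxE.
have CX l : Ck_on k (c @` chart_dom c) (fun u => in_chart c X u 0 l).
  exact: Ck_on_coord oU (sX c ac k).
have := @Ck_on_sum _ _ _ k _ _ (index_enum 'I_d)
  (fun l u => in_chart c X u 0 l * invmx (B u) l i) oU
  (fun l => Ck_onM oU (CX l) (Ck_on_invmx oU uB CB l i)).
apply: Ck_on_ext oU _ => u Uu /=.
have -> : frame_coef x X (chart_inv c u) = in_chart c X u *m invmx (B u).
  apply: canRL (mulmxK (uB u Uu)) _.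
  by rewrite BE mulmxKV // x_frame.2.
by rewrite mxE.
Qed.

(** Smoothness makes the frame generate the smooth fields over the smooth
   functions, so that a property of smooth fields stable under the module
   operations can be checked on the frame. *)
Lemma frame_ind (i0 : 'I_d) (P : vfield M -> Prop) :
  (forall i, P (x i)) ->
  (forall X Y, smooth_vfield X -> smooth_vfield Y -> P X -> P Y ->
     P (vadd X Y)) ->
  (forall f X, smooth_fun f -> smooth_vfield X -> P X -> P (vscale f X)) ->
  forall X, smooth_vfield X -> P X.
Proof.
move=> Px PD PZ X sX.
have -> : X = fun p => \sum_i frame_coef x X p 0 i *: x i p.
  by apply/funext => p; exact: frame_coefE.
pose S r p := \sum_(i <- r) frame_coef x X p 0 i *: x i p.
suff: forall r, smooth_vfield (S r) /\ P (S r) by case/(_ (index_enum _)).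
elim=> [|i r [sS PS]].
  have -> : S [::] = vscale (fun=> 0) (x i0).
    by apply/funext => p; rewrite /S /vscale big_nil scale0r.
  have s0 := smooth_fun_cst 0.
  by split; [apply: smooth_vscale|apply: PZ] => //; exact: x_frame.1.
have -> : S (i :: r) = vadd (vscale (fun p => frame_coef x X p 0 i) (x i)) (S r).
  by apply/funext => p; rewrite /S big_cons.
have sc := smooth_frame_coef X i sX; have sx := x_frame.1 i.
have sZ := smooth_vscale _ _ sc sx.
by split; [exact: smooth_vadd|apply: PD => //; exact: PZ].
Qed.

End Frame.
End Frames.

(** * Reduction to a frame *)

Section Tensoriality.
Context {R : realType} {d : nat} {M : manifoldType R d}.
Context {x : 'I_d -> vfield M} (x_frame : smooth_frame x).
Context {phi : M -> {linear 'rV[R]_d -> 'rV[R]_d}} {g : M -> {biscalar 'rV[R]_d}}.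

Lemma frame_vec_ind (i0 : 'I_d) (p : M) (P : 'rV[R]_d -> Prop) :
  (forall i, P (x i p)) -> (forall u v, P u -> P v -> P (u + v)) ->
  (forall a v, P v -> P (a *: v)) -> forall v, P v.
Proof.
move=> Px PD PZ v.
rewrite (frame_coefE x_frame (fun _ => v) p).
elim/big_ind: _ => // [|i _]; last exact: PZ.
by rewrite -(scale0r (x i0 p)); exact: PZ.
Qed.

Lemma smooth_endo_frame (i0 : 'I_d) :
  (forall i, smooth_vfield (fun p => phi p (x i p))) ->
  forall X, smooth_vfield X -> smooth_vfield (fun p => phi p (X p)).
Proof.
move=> sphi; apply: (frame_ind x_frame i0) => // [X Y sX sY|f X sf sX] sphiX.
  move=> sphiY; rewrite (_ : (fun p => _) =
    vadd (fun p => phi p (X p)) (fun p => phi p (Y p))); first exact: smooth_vadd.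
  by apply/funext => p; rewrite /vadd linearD.
rewrite (_ : (fun p => _) = vscale f (fun p => phi p (X p))).
  exact: smooth_vscale.
by apply/funext => p; rewrite /vscale linearZ.
Qed.

Lemma smooth_form_frame (i0 : 'I_d) (eta : M -> {scalar 'rV[R]_d}) :
  (forall i, smooth_fun (fun p => eta p (x i p))) ->
  forall X, smooth_vfield X -> smooth_fun (fun p => eta p (X p)).
Proof.
move=> seta; apply: (frame_ind x_frame i0) => // [X Y sX sY|f X sf sX] setaX.
  move=> setaY; rewrite (_ : (fun p => _) =
    fun p => eta p (X p) + eta p (Y p)); first exact: smooth_funD.
  by apply/funext => p; rewrite /vadd linearD.
rewrite (_ : (fun p => _) = fun p => f p * eta p (X p)).
  exact: smooth_funM.
by apply/funext => p; rewrite /vscale linearZ.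
Qed.

Lemma smooth_bilinear_frame (i0 : 'I_d) :
  (forall i j, smooth_fun (fun p => g p (x i p) (x j p))) ->
  forall X Y, smooth_vfield X -> smooth_vfield Y ->
    smooth_fun (fun p => g p (X p) (Y p)).
Proof.
move=> sg X Y sX sY; move: X sX.
apply: (frame_ind x_frame i0) => [i|X X' sX sX' IH IH'|f X sf sX IH].
- move: Y sY; apply: (frame_ind x_frame i0) => // [Y Y' sY sY' IH IH'|f Y sf sY IH].
    rewrite (_ : (fun p => _) = fun p => g p (x i p) (Y p) + g p (x i p) (Y' p)).
      exact: smooth_funD.
    by apply/funext => p; rewrite /vadd linearDr.
  rewrite (_ : (fun p => _) = fun p => f p * g p (x i p) (Y p)).
    exact: smooth_funM.
  by apply/funext => p; rewrite /vscale linearZr_LR.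
- rewrite (_ : (fun p => _) = fun p => g p (X p) (Y p) + g p (X' p) (Y p)).
    exact: smooth_funD.
  by apply/funext => p; rewrite /vadd linearDl.
- rewrite (_ : (fun p => _) = fun p => f p * g p (X p) (Y p)).
    exact: smooth_funM.
  by apply/funext => p; rewrite /vscale linearZl_LR.
Qed.

(** Pairing a combination of the frame with y_k isolates the k-th coefficient;
   both the independence of the y_i and the nondegeneracy of g follow. *)
Lemma orthogonal_frame_pairing (p : M) (y : 'I_d -> vfield M) (a : 'rV_d) k :
  (forall i j, i != j -> g p (y i p) (y j p) = 0) ->
  g p (a *m frame_mx y p) (y k p) = a 0 k * g p (y k p) (y k p).
Proof.
move=> gyz; rewrite frame_mxE linear_sumlz (bigD1 k) //= big1 => [|i ik].
  by rewrite addr0 linearZl_LR.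
by rewrite linearZl_LR /= gyz // mulr0.
Qed.

Lemma orthogonal_frame_unit (p : M) (y : 'I_d -> vfield M) :
  (forall i, g p (y i p) (y i p) != 0) ->
  (forall i j, i != j -> g p (y i p) (y j p) = 0) ->
  frame_mx y p \in unitmx.
Proof.
move=> gyy gyz; rewrite -row_free_unit; apply: inj_row_free => a a0.
apply/rowP => k; rewrite mxE; apply/eqP.
have /eqP := orthogonal_frame_pairing p y a k gyz.
by rewrite a0 linear0l eq_sym mulf_eq0 (negbTE (gyy k)) orbF.
Qed.

Context {nabla : vfield M -> vfield M -> vfield M}.
Context (nabla_conn : affine_connection nabla).
Context (phi_smooth :
  forall X, smooth_vfield X -> smooth_vfield (fun p => phi p (X p))).
Implicit Types (X Y Z : vfield M) (f : M -> R) (p : M).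
Local Notation F := (F_tensor nabla phi g).

Lemma F_vadd1 X X' Y Z p :
  smooth_vfield X -> smooth_vfield X' -> smooth_vfield Y ->
  F (vadd X X') Y Z p = F X Y Z p + F X' Y Z p.
Proof.
have [_ [nD _ _ _]] := nabla_conn => sX sX' sY.
rewrite -linearDl /F_tensor /nabla_phi !nD //; last exact: phi_smooth.
by rewrite /vadd linearD /= opprD addrACA.
Qed.

Lemma F_vscale1 f X Y Z p :
  smooth_fun f -> smooth_vfield X -> smooth_vfield Y ->
  F (vscale f X) Y Z p = f p * F X Y Z p.
Proof.
have [_ [_ nZ _ _]] := nabla_conn => sf sX sY.
rewrite -linearZl_LR /F_tensor /nabla_phi !nZ //; last exact: phi_smooth.
by rewrite /vscale linearZ /= scalerBr.
Qed.

Lemma F_vadd2 X Y Y' Z p :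
  smooth_vfield X -> smooth_vfield Y -> smooth_vfield Y' ->
  F X (vadd Y Y') Z p = F X Y Z p + F X Y' Z p.
Proof.
have [_ [_ _ nD _]] := nabla_conn => sX sY sY'.
have phiD : (fun q => phi q (vadd Y Y' q)) =
    vadd (fun q => phi q (Y q)) (fun q => phi q (Y' q)).
  by apply/funext => q; rewrite /vadd linearD.
rewrite -linearDl /F_tensor /nabla_phi phiD !nD //; try exact: phi_smooth.
by rewrite /vadd linearD /= opprD addrACA.
Qed.

(** The connection is a derivation in Y, but the two terms in which f is
   differentiated, (X f) phi Y and phi ((X f) Y), cancel in F. *)
Lemma F_vscale2 f X Y Z p :
  smooth_fun f -> smooth_vfield X -> smooth_vfield Y ->
  F X (vscale f Y) Z p = f p * F X Y Z p.
Proof.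
have [_ [_ _ _ nZ]] := nabla_conn => sf sX sY.
have phiZ : (fun q => phi q (vscale f Y q)) = vscale f (fun q => phi q (Y q)).
  by apply/funext => q; rewrite /vscale linearZ.
rewrite -linearZl_LR /F_tensor /nabla_phi phiZ !nZ //; last exact: phi_smooth.
by rewrite /vscale /vadd linearD !linearZ /= opprD addrACA subrr add0r scalerBr.
Qed.

Lemma F_vadd3 X Y Z Z' p :
  F X Y (vadd Z Z') p = F X Y Z p + F X Y Z' p.
Proof. exact: linearDr. Qed.

Lemma F_vscale3 f X Y Z p : F X Y (vscale f Z) p = f p * F X Y Z p.
Proof. exact: linearZr_LR. Qed.

(** Both sides of the defining identity of F_11 are linear over the smooth
   functions in each of X, Y and Z. *)
Lemma class_F11_frame (i0 : 'I_d) (xi : vfield M) (eta : M -> {scalar 'rV[R]_d}) :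
  (forall i j k p, F (x i) (x j) (x k) p = eta p (x i p) *
     (eta p (x j p) * F xi xi (x k) p + eta p (x k p) * F xi xi (x j) p)) ->
  class_F11 phi xi eta g nabla.
Proof.
move=> Fx F0 omega X Y Z sX sY sZ p; rewrite /omega /F0; move: X sX.
apply: (frame_ind x_frame i0) => [i|X X' sX sX' IH IH'|f X sf sX IH]; last 2 first.
- by rewrite F_vadd1 // IH IH' /vadd linearD /= mulrDl.
- by rewrite F_vscale1 // IH /vscale linearZ /= mulrA.
have sxi := x_frame.1 i; move: Y sY.
apply: (frame_ind x_frame i0) => [j|Y Y' sY sY' IH IH'|f Y sf sY IH]; last 2 first.
- by rewrite F_vadd2 // IH IH' F_vadd3 /vadd linearD /=; ring.
- by rewrite F_vscale2 // IH F_vscale3 /vscale linearZ /=; ring.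
move: Z sZ.
apply: (frame_ind x_frame i0) => [k|Z Z' sZ sZ' IH IH'|f Z sf sZ IH]; last 2 first.
- by rewrite !F_vadd3 IH IH' /vadd linearD /=; ring.
- by rewrite !F_vscale3 IH /vscale linearZ /=; ring.
exact: Fx.
Qed.

End Tensoriality.

(** * Koszul's formula for fields with constant inner products *)

Section Koszul.
Context {R : realType} {d : nat} {M : manifoldType R d}.
Context {g : M -> {biscalar 'rV[R]_d}} (gC : forall p u v, g p u v = g p v u).
Context {nabla : vfield M -> vfield M -> vfield M} (nabla_LC : levi_civita g nabla).
Implicit Types (X Y Z : vfield M) (p : M).

Lemma deriv_cst X (a : R) p : Defs.deriv X (fun _ => a) p = 0.
Proof. by rewrite /Defs.deriv [X in 'd X _](_ : _ = cst a) // diff_cst. Qed.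

Lemma nabla_vscale_cst X Y (a : R) p :
  smooth_vfield X -> smooth_vfield Y ->
  nabla X (vscale (fun _ => a) Y) p = a *: nabla X Y p.
Proof.
have [[_ [_ _ _ nZ]] _ _] := nabla_LC => sX sY.
rewrite nZ //; last exact: smooth_fun_cst.
by rewrite /vadd /vscale deriv_cst scale0r add0r.
Qed.

Lemma nabla_skew X Y Z (a : R) p :
  smooth_vfield X -> smooth_vfield Y -> smooth_vfield Z ->
  (forall q, g q (Y q) (Z q) = a) ->
  g p (nabla X Y p) (Z p) = - g p (nabla X Z p) (Y p).
Proof.
have [_ _ metric] := nabla_LC => sX sY sZ gYZ.
have := metric X Y Z sX sY sZ p.
rewrite (_ : (fun q => _) = fun=> a); last exact/funext.
rewrite deriv_cst.
by move/eqP; rewrite eq_sym addr_eq0 [X in - X]gC => /eqP.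
Qed.

(** By the vanishing of the torsion the three brackets give six terms, which
   cancel in pairs by [nabla_skew] except for two, both equal to
   g(nabla_X Y, Z). *)
Lemma koszul_constant X Y Z (a b c : R) p :
  smooth_vfield X -> smooth_vfield Y -> smooth_vfield Z ->
  (forall q, g q (Y q) (Z q) = a) -> (forall q, g q (Z q) (X q) = b) ->
  (forall q, g q (X q) (Y q) = c) ->
  g p (nabla X Y p) (Z p) *+ 2 = g p (bracket X Y p) (Z p)
    - g p (bracket Y Z p) (X p) + g p (bracket Z X p) (Y p).
Proof.
have [_ torsion _] := nabla_LC => sX sY sZ gYZ gZX gXY.
rewrite -!torsion // !linearBl /=.
have := nabla_skew X Y Z a p sX sY sZ gYZ.
have := nabla_skew Y Z X b p sY sZ sX gZX.
have := nabla_skew Z X Y c p sZ sX sY gXY.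
lra.
Qed.
End Koszul.

(** * The Lie algebra with [x_i, x_0] = lambda_i x_0 *)

(** The brackets are written uniformly in i and j; the value of lambda at i0
   cancels out of the formula. *)
Lemma nabla_frame {R : realType} {d : nat} {M : manifoldType R d}
    {g : M -> {biscalar 'rV[R]_d}} {nabla : vfield M -> vfield M -> vfield M}
    {x : 'I_d -> vfield M} {i0 : 'I_d} {lambda : 'I_d -> R} :
  (forall p u v, g p u v = g p v u) -> levi_civita g nabla ->
  (forall i, smooth_vfield (x i)) ->
  (forall i j, exists a : R, forall p, g p (x i p) (x j p) = a) ->
  (forall k p, g p (x i0 p) (x k p) = (k == i0)%:R) ->
  (forall i j p, bracket (x i) (x j) p =
     (lambda i * (j == i0)%:R - lambda j * (i == i0)%:R) *: x i0 p) ->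
  forall i j k p, g p (nabla (x i) (x j) p) (x k p) =
    (i == i0)%:R * (lambda k * (j == i0)%:R - lambda j * (k == i0)%:R).
Proof.
move=> gC LC sx gx gx0 br i j k p.
have [[a ga] [b gb] [c gc]] := And3 (gx j k) (gx k i) (gx i j).
have := koszul_constant gC LC _ _ _ _ _ _ p (sx i) (sx j) (sx k) ga gb gc.
rewrite !br !linearZl_LR /= !gx0; lra.
Qed.

Lemma ord_pairs {n : nat} (k : 'I_(2 * n).+1) :
  k != ord0 -> exists i j : 'I_(2 * n).+1,
    [/\ (1 <= i <= n)%N, (j = i + n :> nat)%N & k = i \/ k = j].
Proof.
move=> k0; have k_gt0 : (0 < k)%N by rewrite lt0n.
have lt_k := ltn_ord k; case: (leqP k n) => kn.
  have lt_kn : (k + n < (2 * n).+1)%N by lia.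
  by exists k, (Ordinal lt_kn); split=> //; [lia|left].
have lt_kn : (k - n < (2 * n).+1)%N by lia.
by exists (Ordinal lt_kn), k; split=> /=; [lia|lia|right].
Qed.

Theorem proposition3p1 (R : realType) (n : nat)
    (G : lieGroupType R (2 * n).+1)
    (G_connected : connected [set: G])
    (x : 'I_(2 * n).+1 -> vfield G)
    (x_basis : lie_algebra_basis x)
    (lambda : 'I_(2 * n).+1 -> R)
    (bracket_i0 : forall i, i != ord0 -> forall p,
       bracket (x i) (x ord0) p = lambda i *: x ord0 p)
    (bracket_0i : forall i, i != ord0 -> forall p,
       bracket (x ord0) (x i) p = - lambda i *: x ord0 p)
    (bracket_ij : forall i j, i != ord0 -> j != ord0 -> forall p,
       bracket (x i) (x j) p = 0)
    (phi : G -> {linear 'rV[R]_(2 * n).+1 -> 'rV[R]_(2 * n).+1})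
    (xi : vfield G)
    (eta : G -> {scalar 'rV[R]_(2 * n).+1})
    (g : G -> {biscalar 'rV[R]_(2 * n).+1})
    (phi_xi : forall i j : 'I_(2 * n).+1,
       (1 <= i <= n)%N -> (j = i + n :> nat)%N -> forall p,
       phi p (x i p) = x j p /\ phi p (x j p) = - x i p)
    (phi_x0 : forall p, phi p (x ord0 p) = 0)
    (xi_def : forall p, xi p = x ord0 p)
    (eta_x0 : forall p, eta p (x ord0 p) = 1)
    (eta_xj : forall j, j != ord0 -> forall p, eta p (x j p) = 0)
    (g_x0 : forall p, g p (x ord0 p) (x ord0 p) = 1)
    (g_xi : forall i j : 'I_(2 * n).+1,
       (1 <= i <= n)%N -> (j = i + n :> nat)%N -> forall p,
       g p (x i p) (x i p) = 1 /\ g p (x j p) (x j p) = -1)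
    (g_xjk : forall j k : 'I_(2 * n).+1, j != k -> forall p,
       g p (x j p) (x k p) = 0) :
  almost_contact_norden phi xi eta g /\
  (forall nabla : vfield G -> vfield G -> vfield G,
     levi_civita g nabla -> class_F11 phi xi eta g nabla).
Proof.
have xiE : xi = x ord0 by apply/funext.
rewrite xiE {xi xi_def xiE}.
have sx i : smooth_vfield (x i) := (x_basis.1 i).1.
have etaE i p : eta p (x i p) = (i == ord0)%:R.
  by case: eqVneq => [->|/eta_xj].
have g0E i p : g p (x ord0 p) (x i p) = (i == ord0)%:R.
  by rewrite eq_sym; case: eqVneq => [<-|/g_xjk].
have g_diag i : exists2 e : R, e != 0 & forall p, g p (x i p) (x i p) = e.
  have [->|/ord_pairs[a [b [a_n bE]]]] := eqVneq i ord0.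
    by exists 1; rewrite ?oner_eq0.
  case=> ->; [exists 1|exists (-1)]; rewrite ?oppr_eq0 ?oner_eq0 // => p;
    by have [] := g_xi a b a_n bE p.
have gx_cst i j : exists a : R, forall p, g p (x i p) (x j p) = a.
  have [->|ij] := eqVneq i j; first by have [e _] := g_diag j; exists e.
  by exists 0; exact: g_xjk.
have x_frame : smooth_frame x.
  split=> // p; apply: (orthogonal_frame_unit p) => [i|i j /g_xjk //].
  by have [e e0 ->] := g_diag i.
have vec_ind p := frame_vec_ind x_frame ord0 p.
have gC p u v : g p u v = g p v u.
  elim/(vec_ind p): u => [i|u u' IH IH'|a u IH].
  - elim/(vec_ind p): v => [j|v v' IH IH'|a v IH].
    + by have [->//|ij] := eqVneq i j; rewrite !g_xjk // eq_sym.
    + by rewrite linearDl linearDr IH IH'.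
    + by rewrite linearZl_LR linearZr_LR IH.
  - by rewrite linearDl linearDr IH IH'.
  - by rewrite linearZl_LR linearZr_LR IH.
(* eta is the form dual to xi = x_0. *)
have etaE' p v : eta p v = g p (x ord0 p) v.
  elim/(vec_ind p): v => [j|v v' IH IH'|a v IH].
  - by rewrite etaE g0E.
  - by rewrite linearD linearDr IH IH'.
  - by rewrite linearZ linearZr_LR IH.
have phi2 p v : phi p (phi p v) = - v + eta p v *: x ord0 p.
  elim/(vec_ind p): v => [j|v v' IH IH'|a v IH].
  - rewrite etaE; case: eqVneq => [->|/ord_pairs[a [b [a_n bE]]]].
      by rewrite phi_x0 linear0 scale1r addNr.
    have [pa pb] := phi_xi a b a_n bE p.
    by rewrite scale0r addr0; case=> ->; rewrite ?pa ?pb ?linearN ?pa ?pb.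
  - by rewrite !linearD IH IH' /= scalerDl addrACA.
  - by rewrite !linearZ IH /= scalerDr scalerA.
(* On the frame, both sides vanish unless i and j are the two members of one
   pair {a, b = a + n}; they then agree because x_a and x_b have opposite
   squares. *)
have phi_adj p u v : g p (phi p u) v = g p u (phi p v).
  elim/(vec_ind p): u => [i|u u' IH IH'|a u IH]; last 2 first.
  - by rewrite linearD !linearDl IH IH'.
  - by rewrite linearZ !linearZl_LR IH.
  elim/(vec_ind p): v => [j|v v' IH IH'|a v IH]; last 2 first.
  - by rewrite linearDr (linearD (phi p)) linearDr IH IH'.
  - by rewrite linearZr_LR linearZ linearZr_LR IH.
  have gne (k l : 'I_(2 * n).+1) : (k != l :> nat) -> g p (x k p) (x l p) = 0.
    by move=> kl; apply: g_xjk.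
  have [->|/ord_pairs[a [b [a_n bE]]]] := eqVneq i ord0.
    rewrite phi_x0 linear0l.
    have [->|/ord_pairs[a [b [a_n bE]]]] := eqVneq j ord0.
      by rewrite phi_x0 linear0r.
    have [pa pb] := phi_xi a b a_n bE p.
    by case=> ->; rewrite ?pa ?pb ?linearNr gne ?oppr0 //=; lia.
  have [pa pb] := phi_xi a b a_n bE p; have [ga gb] := g_xi a b a_n bE p.
  have [->|/ord_pairs[a' [b' [a'_n b'E]]]] := eqVneq j ord0.
    rewrite phi_x0 linear0r.
    by case=> ->; rewrite ?pa ?pb ?linearNl gne ?oppr0 //=; lia.
  have [pa' pb'] := phi_xi a' b' a'_n b'E p.
  have aE : a = a' -> b = b' by move=> aa; apply: val_inj; rewrite /= bE b'E aa.
  have [aa|aa] := eqVneq a a'.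
    have bb := aE aa; rewrite -aa -bb in pa' pb' *.
    have gab : g p (x a p) (x b p) = 0 by apply: gne; lia.
    have gba : g p (x b p) (x a p) = 0 by apply: gne; lia.
    by case=> ->; case=> ->;
      rewrite ?pa ?pb ?linearNl ?linearNr ?ga ?gb ?gab ?gba ?oppr0.
  have {}aa : (a != a' :> nat) := aa.
  case=> ->; case=> ->; rewrite ?pa ?pb ?pa' ?pb' ?linearNl ?linearNr;
    by rewrite !gne ?oppr0 //=; lia.
(* The case i = ord0 is covered with s = 0; the condition on s and k expresses
   that phi x_i has no component along x_0. *)
have phi_frame i : exists (s : R) k, s * (k == ord0)%:R = 0 /\
    forall p, phi p (x i p) = s *: x k p.
  have [->|/ord_pairs[a [b [a_n bE]]]] := eqVneq i ord0.
    by exists 0, ord0; split=> [|p]; rewrite ?mul0r // scale0r phi_x0.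
  have a0 : (a == ord0) = false by apply/negbTE; rewrite -val_eqE /=; lia.
  have b0 : (b == ord0) = false by apply/negbTE; rewrite -val_eqE /=; lia.
  case=> ->; [exists 1, b|exists (-1), a]; rewrite ?a0 ?b0 mulr0; split=> // p;
    by have [pa pb] := phi_xi a b a_n bE p; rewrite ?pa ?pb ?scale1r ?scaleN1r.
have phi_smooth : forall X, smooth_vfield X -> smooth_vfield (fun p => phi p (X p)).
  apply: (smooth_endo_frame x_frame ord0) => i; have [s [k [_ phiE]]] := phi_frame i.
  rewrite (_ : (fun p => _) = vscale (fun _ => s) (x k)); last exact/funext.
  exact: smooth_vscale (smooth_fun_cst s) (sx k).
split=> [|nabla LC].
  split.
  - split=> //.
    apply: (smooth_form_frame x_frame ord0) => i.
    rewrite (_ : (fun p => _) = fun=> (i == ord0)%:R); last exact/funext.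
    exact: smooth_fun_cst.
  - split=> // [p u u0|].
    + have <- : u *m invmx (frame_mx x p) *m frame_mx x p = u.
        by rewrite mulmxKV // x_frame.2.
      suff -> : u *m invmx (frame_mx x p) = 0 by rewrite mul0mx.
      apply/rowP => k; rewrite [RHS]mxE; apply/eqP; have [e e0 ge] := g_diag k.
      have /eqP := orthogonal_frame_pairing p x (u *m invmx (frame_mx x p)) k
        (fun i j ij => g_xjk i j ij p).
      by rewrite mulmxKV ?x_frame.2 // u0 ge eq_sym mulf_eq0 (negbTE e0) orbF.
    + apply: (smooth_bilinear_frame x_frame ord0) => i j.
      have [a ga] := gx_cst i j.
      rewrite (_ : (fun p => _) = fun=> a); last exact/funext.
      exact: smooth_fun_cst.
  - move=> p u v; rewrite phi_adj phi2 linearDr linearNr linearZr_LR /=.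
    by rewrite (gC p u (x ord0 p)) -etaE' [eta p v * _]mulrC.
have br i j p : bracket (x i) (x j) p =
    (lambda i * (j == ord0)%:R - lambda j * (i == ord0)%:R) *: x ord0 p.
  have [->|i0] := eqVneq i ord0; have [->|j0] := eqVneq j ord0.
  - by rewrite subrr scale0r /bracket subrr.
  - by rewrite mulr0 mulr1 sub0r bracket_0i.
  - by rewrite mulr0 mulr1 subr0 bracket_i0.
  - by rewrite !mulr0 subrr scale0r bracket_ij.
have nablaE := nabla_frame gC LC sx gx_cst g0E br.
have FE i j k p s j' t k' :
    s * (j' == ord0)%:R = 0 -> (forall q, phi q (x j q) = s *: x j' q) ->
    t * (k' == ord0)%:R = 0 -> (forall q, phi q (x k q) = t *: x k' q) ->
    F_tensor nabla phi g (x i) (x j) (x k) p = (i == ord0)%:R *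
      (- (s * lambda j') * (k == ord0)%:R - t * lambda k' * (j == ord0)%:R).
  (* Self-adjointness moves phi from nabla onto x_k; then s0 and t0 kill the
     terms where the images of phi are paired with x_0. *)
  move=> s0 phij t0 phik; rewrite /F_tensor /nabla_phi linearBl /= phi_adj phik.
  have -> : (fun q => phi q (x j q)) = vscale (fun=> s) (x j') by exact/funext.
  rewrite (nabla_vscale_cst LC) // linearZl_LR linearZr_LR /= !nablaE.
  by ring: s0 t0.
have [conn _ _] := LC.
apply: (class_F11_frame x_frame conn phi_smooth ord0) => // i j k p.
have [s [j' [s0 phij]]] := phi_frame j; have [t [k' [t0 phik]]] := phi_frame k.
(* omega is the case i = j = 0 of FE, for which phi x_0 = 0 *: x_0. *)
have phi0 q : phi q (x ord0 q) = 0 *: x ord0 q by rewrite phi_x0 scale0r.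
rewrite (FE i j k p s j' t k') // (FE _ _ k p 0 ord0 t k') ?mul0r //.
by rewrite (FE _ _ j p 0 ord0 s j') ?mul0r // !etaE eqxx mulr1n; ring.
Qed.
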